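(* Let $n\ge2$, let $R$ be a commutative ring with unit, and let $\theta$ be an $R$-valued Magnus expansion of the free group $F_n$, with first and second Johnson maps $\tau^\theta_1:\mathrm{Aut}(F_n)\to H^*\otimes H^{\otimes2}$ and $\tau^\theta_2:\mathrm{Aut}(F_n)\to H^*\otimes H^{\otimes3}$. Then, in the normalized standard cochain complexes of $\mathrm{Aut}(F_n)$, $$-d\tau^\theta_1=0\in C^*(\mathrm{Aut}(F_n);H^*\otimes H^{\otimes2}),$$ $$-d\tau^\theta_2=(\tau^\theta_1\otimes1+1\otimes\tau^\theta_1)\cup\tau^\theta_1\in C^*(\mathrm{Aut}(F_n);H^*\otimes H^{\otimes3}),$$ where in the second formula the cup product is followed by the composition map $\mathrm{Hom}(H^{\otimes2},H^{\otimes3})\otimes\mathrm{Hom}(H,H^{\otimes2})\to\mathrm{Hom}(H,H^{\otimes3})=H^*\otimes H^{\otimes3}$, $f\otimes g\mapsto f\circ g$, and $1$ denotes $1_H$.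
   Context: $R$ is a commutative ring with unit, $F_n$ a free group of rank $n\ge2$, $H=H_1(F_n;R)=F_n^{\mathrm{abel}}\otimes_{\mathbb Z}R$, $H^*=\mathrm{Hom}_R(H,R)$, tensor products and Hom over $R$; $[\gamma]\in H$ is the class of $\gamma\in F_n$. $\widehat T=\prod_{m\ge0}H^{\otimes m}$, $\widehat T_p=\prod_{m\ge p}H^{\otimes m}$. A Magnus expansion is a group homomorphism $\theta:F_n\to1+\widehat T_1$ with $\theta(\gamma)\equiv1+[\gamma]\pmod{\widehat T_2}$ for all $\gamma$. $IA(\widehat T)$ is the group of $R$-algebra automorphisms $U$ of $\widehat T$ with $U(\widehat T_p)=\widehat T_p$ for all $p\geq 1$ inducing the identity on $\widehat T_1/\widehat T_2=H$. The map $E:IA(\widehat T)\to\mathrm{Hom}(H,\widehat T_2)$, $U\mapsto U|_H-1_H$, is a bijection. $IA(\widehat T)$ acts freely and transitively on the set of Magnus expansions by $U\cdot\theta=U\circ\theta$. For $\varphi\in\mathrm{Aut}(F_n)$, $|\varphi|\in GL(H)$ is the induced automorphism of $H$, also regarded as the automorphism of $\widehat T$ acting on $H^{\otimes m}$ by $|\varphi|^{\otimes m}$. The total Johnson map $\tau^\theta(\varphi)\in IA(\widehat T)$ is the unique element with $|\varphi|\circ\theta\circ\varphi^{-1}=\tau^\theta(\varphi)^{-1}\circ\theta$; equivalently $\theta\circ\varphi=\tau^\theta(\varphi)\circ|\varphi|\circ\theta$. The $p$-th Johnson map $\tau^\theta_p:\mathrm{Aut}(F_n)\to\mathrm{Hom}(H,H^{\otimes(p+1)})=H^*\otimes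 H^{\otimes(p+1)}$ is the $p$-th component of $E\tau^\theta(\varphi)=\sum_{p\ge1}\tau^\theta_p(\varphi)$. $\mathrm{Aut}(F_n)$ acts on $\mathrm{Hom}(H,H^{\otimes(p+1)})$ by $\varphi\cdot v=|\varphi|^{\otimes(p+1)}\circ v\circ|\varphi|^{-1}$. $C^*(G;M)$ is the normalized standard (inhomogeneous) complex of a group $G$; for a 1-cochain $f$, $df(x,y)=x f(y)-f(xy)+f(x)$; the Alexander–Whitney cup product of 1-cochains is $(f\cup g)(x,y)=f(x)\otimes x\,g(y)$. *)

(* Defs.v *)
From HB Require Import structures.
From mathcomp Require Import all_boot all_algebra.
From mathcomp Require Import boolp classical_sets.

Set Implicit Arguments.
Unset Strict Implicit.
Unset Printing Implicit Defensive.

Import GRing.Theory.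
Local Open Scope ring_scope.

Definition free_basis (I : Type) (F : groupType) (x : I -> F) : Prop :=
  forall (G : groupType) (f : I -> G),
    exists g : {multiplicative F -> G},
      (forall i, g (x i) = f i) /\
      (forall g' : {multiplicative F -> G}, (forall i, g' (x i) = f i) -> g' =1 g).

Definition free_of_rank (n : nat) (F : groupType) : Prop :=
  exists x : 'I_n -> F, free_basis x.

Record aut (G : groupType) := Aut {
  aut_fun :> G -> G;
  aut_inv : G -> G;
  autM : {morph aut_fun : x y / (x * y)%g};
  autK : cancel aut_fun aut_inv;
  autKV : cancel aut_inv aut_fun }.

Section AutGroup.
Variable G : groupType.
Implicit Types f g h : aut G.

Lemma aut_eq f g : f =1 g -> f = g.
Proof.
case: f g => [f f' fM fK f'K] [g g' gM gK g'K] /= /funext efg.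
case: _ / efg gM gK g'K => gM gK g'K.
have eV : f' = g' by apply/funext => x; rewrite -{1}(g'K x) fK.
case: _ / eV gK g'K => gK g'K.
by congr Aut; exact: Prop_irrelevance.
Qed.

Definition aut_one : aut G :=
  @Aut G id id (fun _ _ => erefl) (fun _ => erefl) (fun _ => erefl).

Definition aut_mul f g : aut G.
Proof.
apply: (@Aut G (f \o g) (aut_inv g \o aut_inv f)).
- by move=> x y /=; rewrite !autM.
- by move=> x /=; rewrite !autK.
- by move=> x /=; rewrite !autKV.
Defined.

Definition aut_V f : aut G.
Proof.
apply: (@Aut G (aut_inv f) f).
- by move=> x y; rewrite -{1}(autKV f x) -{1}(autKV f y) -autM autK.
- exact: autKV.
- exact: autK.
Defined.

Lemma aut_mulA : associative aut_mul.
Proof. by move=> f g h; apply: aut_eq. Qed.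
Lemma aut_mul1g : left_id aut_one aut_mul.
Proof. by move=> f; apply: aut_eq. Qed.
Lemma aut_mulg1 : right_id aut_one aut_mul.
Proof. by move=> f; apply: aut_eq. Qed.
Lemma aut_mulVg : left_inverse aut_one aut_V aut_mul.
Proof. by move=> f; apply: aut_eq => x /=; rewrite autK. Qed.
Lemma aut_mulgV : right_inverse aut_one aut_V aut_mul.
Proof. by move=> f; apply: aut_eq => x /=; rewrite autKV. Qed.

HB.instance Definition _ := gen_eqMixin (aut G).
HB.instance Definition _ := gen_choiceMixin (aut G).
HB.instance Definition _ :=
  isGroup.Build (aut G) aut_mulA aut_mul1g aut_mulg1 aut_mulVg aut_mulgV.
End AutGroup.

Section HomModule.
Variables (R : comPzRingType) (U V : lmodType R).
Implicit Types f g h : {linear U -> V}.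

Lemma lin_eq f g : f =1 g -> f = g.
Proof.
move=> /funext; case: f g => [f [[fA] [fL]]] [g [[gA] [gL]]] /= efg.
case: _ / efg gA gL => gA gL.
by rewrite (Prop_irrelevance fA gA) (Prop_irrelevance fL gL).
Qed.

HB.instance Definition _ := gen_eqMixin {linear U -> V}.
HB.instance Definition _ := gen_choiceMixin {linear U -> V}.

Definition lin_zero : {linear U -> V} := \0.
Definition lin_opp f : {linear U -> V} := \- f.
Definition lin_add f g : {linear U -> V} := f \+ g.
Definition lin_scale (a : R) f : {linear U -> V} := a \*: f.

Lemma lin_addA : associative lin_add.
Proof. by move=> f g h; apply: lin_eq => x /=; rewrite addrA. Qed.
Lemma lin_addC : commutative lin_add.
Proof. by move=> f g; apply: lin_eq => x /=; rewrite addrC. Qed.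
Lemma lin_add0 : left_id lin_zero lin_add.
Proof. by move=> f; apply: lin_eq => x /=; rewrite add0r. Qed.
Lemma lin_addN : left_inverse lin_zero lin_opp lin_add.
Proof. by move=> f; apply: lin_eq => x /=; rewrite addNr. Qed.
HB.instance Definition _ := GRing.isZmodule.Build {linear U -> V}
  lin_addA lin_addC lin_add0 lin_addN.

Lemma lin_scaleA a b f : lin_scale a (lin_scale b f) = lin_scale (a * b) f.
Proof. by apply: lin_eq => x /=; rewrite scalerA. Qed.
Lemma lin_scale1 : left_id 1 lin_scale.
Proof. by move=> f; apply: lin_eq => x /=; rewrite scale1r. Qed.
Lemma lin_scaleDr : right_distributive lin_scale +%R.
Proof. by move=> a f g; apply: lin_eq => x /=; rewrite scalerDr. Qed.
Lemma lin_scaleDl f : {morph lin_scale^~ f : a b / a + b}.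
Proof. by move=> a b; apply: lin_eq => x /=; rewrite scalerDl. Qed.
HB.instance Definition _ := GRing.Zmodule_isLmodule.Build R {linear U -> V}
  lin_scaleA lin_scale1 lin_scaleDr lin_scaleDl.
End HomModule.

(* [univ C] is the R-module generated by symbols [univ_gen x], x : X, subject
   to the relations that hold for all maps of class C from X to R-modules:
   formal sums \sum_i a_i x_i, two of them being identified when no map of
   class C separates them. *)
Section UniversalModule.
Local Open Scope quotient_scope.
Variables (R : comPzRingType) (X : choiceType).
Variable C : forall P : lmodType R, (X -> P) -> Prop.
Implicit Types s t : seq (R * X).

Definition formal_eval (P : lmodType R) (f : X -> P) (s : seq (R * X)) : P :=
  \sum_(a <- s) a.1 *: f a.2.

Definition univ_eqv s t : bool :=
  `[< forall (P : lmodType R) (f : X -> P), C f ->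
        formal_eval f s = formal_eval f t >].

Lemma univ_eqv_refl : reflexive univ_eqv.
Proof. by move=> s; apply/asboolP. Qed.
Lemma univ_eqv_sym : symmetric univ_eqv.
Proof. by move=> s t; apply/asboolP/asboolP => e P f Cf; rewrite e. Qed.
Lemma univ_eqv_trans : transitive univ_eqv.
Proof.
move=> t s u /asboolP e1 /asboolP e2; apply/asboolP => P f Cf.
by rewrite e1 // e2.
Qed.
Canonical univ_equiv :=
  EquivRel univ_eqv univ_eqv_refl univ_eqv_sym univ_eqv_trans.

Definition univ : Type := {eq_quot univ_equiv}.
HB.instance Definition _ := Choice.on univ.
HB.instance Definition _ := EqQuotient.on univ.

Definition univ_gen (x : X) : univ := \pi_univ [:: (1, x)].

(* The linear extension of f to [univ C], when f is of class C. *)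
Definition univ_lift (P : lmodType R) (f : X -> P) (q : univ) : P :=
  formal_eval f (repr q).

Lemma univ_lift_pi (P : lmodType R) (f : X -> P) s :
  C f -> univ_lift f (\pi_univ s) = formal_eval f s.
Proof.
move=> Cf; rewrite /univ_lift.
have /eqmodP/asboolP e : repr (\pi_univ s) = s %[mod univ] by rewrite reprK.
exact: e.
Qed.

Lemma univ_sep (q q' : univ) :
  (forall (P : lmodType R) (f : X -> P), C f -> univ_lift f q = univ_lift f q') ->
  q = q'.
Proof.
by move=> e; rewrite -[q]reprK -[q']reprK; apply/eqmodP/asboolP.
Qed.

Definition univ_zero : univ := \pi_univ [::].
Definition univ_add (q q' : univ) : univ := \pi_univ (repr q ++ repr q').
Definition univ_scale (a : R) (q : univ) : univ :=
  \pi_univ [seq (a * b.1, b.2) | b <- repr q].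
Definition univ_opp (q : univ) : univ := univ_scale (- 1) q.

Section Lift.
Variables (P : lmodType R) (f : X -> P).
Hypothesis Cf : C f.

Lemma univ_lift0 : univ_lift f univ_zero = 0.
Proof. by rewrite univ_lift_pi // /formal_eval big_nil. Qed.
Lemma univ_liftD q q' :
  univ_lift f (univ_add q q') = univ_lift f q + univ_lift f q'.
Proof. by rewrite univ_lift_pi // /formal_eval big_cat. Qed.
Lemma univ_liftZ a q : univ_lift f (univ_scale a q) = a *: univ_lift f q.
Proof.
rewrite univ_lift_pi // /formal_eval big_map scaler_sumr.
by apply: eq_bigr => b _; rewrite scalerA.
Qed.
Lemma univ_liftN q : univ_lift f (univ_opp q) = - univ_lift f q.
Proof. by rewrite univ_liftZ scaleN1r. Qed.
End Lift.
Let liftE := (univ_lift0, univ_liftD, univ_liftZ, univ_liftN).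

Lemma univ_addA : associative univ_add.
Proof. by move=> q r s; apply: univ_sep => P f Cf; rewrite !liftE // addrA. Qed.
Lemma univ_addC : commutative univ_add.
Proof. by move=> q r; apply: univ_sep => P f Cf; rewrite !liftE // addrC. Qed.
Lemma univ_add0 : left_id univ_zero univ_add.
Proof. by move=> q; apply: univ_sep => P f Cf; rewrite !liftE // add0r. Qed.
Lemma univ_addN : left_inverse univ_zero univ_opp univ_add.
Proof. by move=> q; apply: univ_sep => P f Cf; rewrite !liftE // addNr. Qed.
HB.instance Definition _ := GRing.isZmodule.Build univ
  univ_addA univ_addC univ_add0 univ_addN.

Lemma univ_scaleA a b q : univ_scale a (univ_scale b q) = univ_scale (a * b) q.
Proof. by apply: univ_sep => P f Cf; rewrite !liftE // scalerA. Qed.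
Lemma univ_scale1 : left_id 1 univ_scale.
Proof. by move=> q; apply: univ_sep => P f Cf; rewrite !liftE // scale1r. Qed.
Lemma univ_scaleDr : right_distributive univ_scale +%R.
Proof. by move=> a q r; apply: univ_sep => P f Cf; rewrite !liftE // scalerDr. Qed.
Lemma univ_scaleDl q : {morph univ_scale^~ q : a b / a + b}.
Proof. by move=> a b; apply: univ_sep => P f Cf; rewrite !liftE // scalerDl. Qed.
HB.instance Definition _ := GRing.Zmodule_isLmodule.Build R univ
  univ_scaleA univ_scale1 univ_scaleDr univ_scaleDl.

Lemma univ_lift_gen (P : lmodType R) (f : X -> P) x :
  C f -> univ_lift f (univ_gen x) = f x.
Proof.
by move=> Cf; rewrite univ_lift_pi // /formal_eval big_seq1 scale1r.
Qed.

Lemma univ_genE (q : univ) : q = \sum_(a <- repr q) a.1 *: univ_gen a.2.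
Proof.
apply: univ_sep => P f Cf; rewrite {1}/univ_lift /formal_eval.
elim: (repr q) => [|a s IHs]; first by rewrite !big_nil univ_lift0.
by rewrite !big_cons univ_liftD // -IHs univ_liftZ // univ_lift_gen.
Qed.

Lemma univ_ext (P : lmodType R) (f g : {linear univ -> P}) :
  (forall x, f (univ_gen x) = g (univ_gen x)) -> f =1 g.
Proof.
move=> efg q; rewrite (univ_genE q) !linear_sum.
by apply: eq_bigr => a _; rewrite !linearZ /= efg.
Qed.

Lemma univ_lift_linear (P : lmodType R) (f : X -> P) : C f -> linear (univ_lift f).
Proof. by move=> Cf a q r; rewrite univ_liftD // univ_liftZ. Qed.

Definition univ_lin (P : lmodType R) (f : X -> P) (Cf : C f) : {linear univ -> P} :=
  HB.pack (univ_lift f)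
    (GRing.isLinear.Build R univ P *:%R (univ_lift f) (univ_lift_linear Cf)).
End UniversalModule.

Section H1.
Variables (R : comPzRingType) (F : groupType).

Definition H1_class (P : lmodType R) (f : F -> P) : Prop :=
  forall x y : F, f (x * y)%g = f x + f y.

(* An R-linear map from F^ab (x)_Z R to P is the same as a homomorphism from F
   to the additive group of P. *)
Definition H1 : lmodType R := univ H1_class.

Definition cls (x : F) : H1 := univ_gen H1_class x.

Lemma clsM : H1_class cls.
Proof.
by move=> x y; apply: univ_sep => P f Cf; rewrite univ_liftD // !univ_lift_gen.
Qed.

Lemma cls_aut (phi : aut F) : H1_class (fun x => cls (phi x)).
Proof. by move=> x y; rewrite autM clsM. Qed.

(* |phi|; see [H1_mapK] and [H1_mapKV] for |phi^-1| = |phi|^-1. *)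
Definition H1_map (phi : aut F) : {linear H1 -> H1} := univ_lin (cls_aut phi).

Lemma H1_map_cls phi x : H1_map phi (cls x) = cls (phi x).
Proof. exact: (univ_lift_gen x (cls_aut phi)). Qed.

Lemma H1_mapK (phi : aut F) : cancel (H1_map phi) (H1_map (phi^-1)%g).
Proof.
apply: (univ_ext (f := H1_map (phi^-1)%g \o H1_map phi) (g := idfun)) => x.
apply: etrans (congr1 (H1_map phi^-1%g) (H1_map_cls phi x)) _.
by rewrite H1_map_cls; congr (cls _); exact: (autK phi).
Qed.

Lemma H1_mapKV (phi : aut F) : cancel (H1_map (phi^-1)%g) (H1_map phi).
Proof.
apply: (univ_ext (f := H1_map phi \o H1_map (phi^-1)%g) (g := idfun)) => x.
apply: etrans (congr1 (H1_map phi) (H1_map_cls phi^-1%g x)) _.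
by rewrite H1_map_cls; congr (cls _); exact: (autKV phi).
Qed.
End H1.

Section Tensor.
Variable R : comPzRingType.

Definition bilin (M N : lmodType R) (P : lmodType R) (b : M * N -> P) : Prop :=
  (forall y, linear (fun x => b (x, y))) /\ (forall x, linear (fun y => b (x, y))).

Definition tensor (M N : lmodType R) : lmodType R := univ (@bilin M N).

Definition tens (M N : lmodType R) (x : M) (y : N) : tensor M N :=
  univ_gen (@bilin M N) (x, y).

Definition tensor_lift (M N P : lmodType R) (b : M -> N -> P) :
  tensor M N -> P := univ_lift (C := @bilin M N) (fun u => b u.1 u.2).

Definition tensor_lin (M N P : lmodType R) (b : M -> N -> P)
    (Cb : bilin (fun u => b u.1 u.2)) : {linear tensor M N -> P} :=
  univ_lin Cb.

Lemma tens_bilin (M N : lmodType R) :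
  bilin (fun u : M * N => tens u.1 u.2).
Proof.
split=> [y a x x'|x a y y'] /=; apply: univ_sep => P f Cf;
  rewrite univ_liftD // univ_liftZ // !univ_lift_gen //; case: Cf => Cl Cr;
  [exact: Cl | exact: Cr].
Qed.

Lemma tensor_map_bilin (M M' N N' : lmodType R)
    (f : {linear M -> M'}) (g : {linear N -> N'}) :
  bilin (fun u : M * N => tens (f u.1) (g u.2)).
Proof.
have [Bl Br] := tens_bilin M' N'.
by split=> [y a x x'|x a y y'] /=; rewrite linearP; [exact: Bl | exact: Br].
Qed.

Definition tensor_map (M M' N N' : lmodType R)
    (f : {linear M -> M'}) (g : {linear N -> N'}) :
  {linear tensor M N -> tensor M' N'} :=
  tensor_lin (b := fun x y => tens (f x) (g y)) (tensor_map_bilin f g).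
End Tensor.

Section TensorPower.
Variables (R : comPzRingType) (H : lmodType R).

(* The case m = 1 is singled out so that H^{(x)1} is H itself, not H (x) R. *)
Fixpoint tpow (m : nat) : lmodType R :=
  match m with
  | 0 => R^o
  | m'.+1 => match m' with 0 => H | _.+1 => tensor H (tpow m') end
  end.

(* The canonical map H x H^{(x)m} -> H^{(x)(m+1)}. *)
Definition hmul (h : H) (m : nat) : tpow m -> tpow m.+1 :=
  match m return tpow m -> tpow m.+1 with
  | 0 => fun r : R => r *: h
  | _.+1 => fun t => tens h t
  end.

(* The canonical map H^{(x)p} x H^{(x)q} -> H^{(x)(p+q)}. *)
Fixpoint tmul (q : nat) (t : tpow q) (p : nat) : tpow p -> tpow (p + q) :=
  match p return tpow p -> tpow (p + q) with
  | 0 => fun r : R => r *: t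
  | p'.+1 =>
    match p' return (tpow p' -> tpow (p' + q)) -> tpow p'.+1 -> tpow (p'.+1 + q)
    with
    | 0 => fun _ h => hmul h t
    | _.+1 => fun mul_t => tensor_lift (fun h s => hmul h (mul_t s))
    end (tmul t (p := p'))
  end.

Fixpoint tpow_map (f : {linear H -> H}) (m : nat) : {linear tpow m -> tpow m} :=
  match m return {linear tpow m -> tpow m} with
  | 0 => idfun
  | m'.+1 =>
    match m' return {linear tpow m' -> tpow m'} ->
                    {linear tpow m'.+1 -> tpow m'.+1} with
    | 0 => fun _ => f
    | _.+1 => fun fm => tensor_map f fm
    end (tpow_map f m')
  end.

Lemma hmul_bilin m : bilin (fun u : H * tpow m => hmul u.1 u.2).
Proof.
case: m => [|m]; last exact: tens_bilin.
split=> [r a x x'|x a r r'] /=; first by rewrite scalerDr !scalerA mulrC.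
by rewrite scalerDl scalerA.
Qed.

Lemma tmul_bilin p q : bilin (fun u : tpow p * tpow q => tmul u.2 u.1).
Proof.
elim: p => [|p [IHl IHr]].
  split=> [t a r r'|r a t t'] /=; first by rewrite scalerDl scalerA.
  by rewrite scalerDr !scalerA mulrC.
have [Bl Br] := hmul_bilin (p + q).
case: p => [|p] in IHl IHr Bl Br *; first exact: hmul_bilin.
have Cb (t : tpow q) : bilin (fun u : H * tpow p.+1 => hmul u.1 (tmul t u.2)).
  split=> [y a x x'|x a y y']; first exact: Bl.
  by rewrite [LHS](congr1 (@hmul x _) (IHl t a y y')); exact: Br.
split=> [t|s a t t']; first exact: (univ_lift_linear (Cb t)).
rewrite /= /tensor_lift /univ_lift /formal_eval scaler_sumr -big_split.
apply: eq_bigr => u _.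
rewrite [X in _ *: X](congr1 (@hmul u.2.1 _) (IHr u.2.2 a t t')).
rewrite [X in _ *: X](Br u.2.1 a) scalerDr !scalerA.
by rewrite mulrC.
Qed.

Section Tens11.
Variables (p q : nat) (f : {linear H -> tpow p}) (g : {linear H -> tpow q}).

Lemma tens11_bilin : bilin (fun u : H * H => tmul (g u.2) (f u.1)).
Proof.
have [Bl Br] := tmul_bilin p q.
by split=> [y a x x'|x a y y'] /=; rewrite linearP; [exact: Bl | exact: Br].
Qed.

Definition tens11 : {linear tpow 2 -> tpow (p + q)} :=
  tensor_lin (b := fun x y => tmul (g y) (f x)) tens11_bilin.
End Tens11.

Definition That : Type := forall m : nat, tpow m.

HB.instance Definition _ := Choice.copy That (forall m : nat, tpow m).

Definition That_zero : That := fun _ => 0.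
Definition That_opp (a : That) : That := fun m => - a m.
Definition That_add (a b : That) : That := fun m => a m + b m.
Definition That_scale (r : R) (a : That) : That := fun m => r *: a m.

Lemma That_addA : associative That_add.
Proof. by move=> a b c; apply/functional_extensionality_dep => m; exact: addrA. Qed.
Lemma That_addC : commutative That_add.
Proof. by move=> a b; apply/functional_extensionality_dep => m; exact: addrC. Qed.
Lemma That_add0 : left_id That_zero That_add.
Proof. by move=> a; apply/functional_extensionality_dep => m; exact: add0r. Qed.
Lemma That_addN : left_inverse That_zero That_opp That_add.
Proof. by move=> a; apply/functional_extensionality_dep => m; exact: addNr. Qed.
HB.instance Definition _ := GRing.isZmodule.Build That
  That_addA That_addC That_add0 That_addN.

Lemma That_scaleA r s a : That_scale r (That_scale s a) = That_scale (r * s) a.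
Proof. by apply/functional_extensionality_dep => m; exact: scalerA. Qed.
Lemma That_scale1 : left_id 1 That_scale.
Proof. by move=> a; apply/functional_extensionality_dep => m; exact: scale1r. Qed.
Lemma That_scaleDr : right_distributive That_scale +%R.
Proof. by move=> r a b; apply/functional_extensionality_dep => m; exact: scalerDr. Qed.
Lemma That_scaleDl a : {morph That_scale^~ a : r s / r + s}.
Proof. by move=> r s; apply/functional_extensionality_dep => m; exact: scalerDl. Qed.
HB.instance Definition _ := GRing.Zmodule_isLmodule.Build R That
  That_scaleA That_scale1 That_scaleDr That_scaleDl.

Definition That_one : That :=
  fun m => match m return tpow m with 0 => (1 : R) | _ => 0 end.

Definition That_H (h : H) : That :=
  fun m => match m return tpow m with 1 => h | _ => 0 end.

(* (a b)_m = \sum_{i + j = m} a_i (x) b_j; the cast identifies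
   H^{(x)(i + (m - i))} with H^{(x)m}. *)
Definition That_mul (a b : That) : That := fun m =>
  \sum_(i < m.+1)
    ecast k (tpow k) (subnKC (leq_ord i)) (tmul (b (m - i)%N) (a i)).

Definition That_map (f : {linear H -> H}) (a : That) : That :=
  fun m => tpow_map f m (a m).

Definition That_ge (p : nat) : set That :=
  [set a | forall m, (m < p)%N -> a m = 0].

Lemma That_H_linear : linear That_H.
Proof.
move=> a h h'; apply/functional_extensionality_dep.
by case=> [|[|m]]; rewrite [RHS]/GRing.add //= /That_add /GRing.scale /= /That_scale
  ?scaler0 ?addr0.
Qed.
HB.instance Definition _ := GRing.isLinear.Build R H That *:%R That_H That_H_linear.

Definition That_comp (m : nat) (a : That) : tpow m := a m.
Lemma That_comp_linear m : linear (That_comp m).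
Proof. by []. Qed.
HB.instance Definition _ m :=
  GRing.isLinear.Build R That (tpow m) *:%R (That_comp m) (That_comp_linear m).

Record in_IA (U : {linear That -> That}) : Prop := InIA {
  IA_bij : bijective U;
  IA_one : U That_one = That_one;
  IA_mul : forall a b, U (That_mul a b) = That_mul (U a) (U b);
  IA_filt : forall p, (1 <= p)%N -> image (That_ge p) U = That_ge p;
  IA_id : forall a, That_ge 1 a -> That_ge 2 (U a - a) }.

Definition E_IA (U : {linear That -> That}) : {linear H -> That} :=
  (U \o That_H) \- That_H.
End TensorPower.

Section Johnson.
Variables (R : comPzRingType) (F : groupType).
Local Notation H := (H1 R F).

Record magnus_expansion (theta : F -> That H) : Prop := MagnusExpansion {
  magnusM : forall x y, theta (x * y)%g = That_mul (theta x) (theta y);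
  magnus_one : forall x, That_ge 1 (theta x - That_one H);
  magnus_cls : forall x, That_ge 2 (theta x - (That_one H + That_H (cls R x))) }.

Variable theta : F -> That H.

(* The element U of IA(T^) with theta o phi = U o |phi| o theta; it exists and
   is unique when F is free and theta is a Magnus expansion. *)
Definition total_johnson (phi : aut F) : {linear That H -> That H} :=
  xget (idfun : {linear That H -> That H}) [set U | in_IA U /\
    forall x, theta (phi x) = U (That_map (H1_map R phi) (theta x))].

Definition johnson (p : nat) (phi : aut F) : {linear H -> tpow H p.+1} :=
  That_comp p.+1 \o E_IA (total_johnson phi).

(* The action of Aut(F) on Hom(H, H^{(x)(p+1)});
   |phi|^-1 is written |phi^-1|. *)
Definition hom_act (p : nat) (phi : aut F) (v : {linear H -> tpow H p.+1}) :
    {linear H -> tpow H p.+1} :=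
  (tpow_map (H1_map R phi) p.+1 \o v) \o H1_map R (phi^-1)%g.
End Johnson.
Arguments hom_act {R F} p phi v.

Section Cochains.
Variables (R : comPzRingType) (G : groupType).

Definition normalized1 (M : lmodType R) (f : G -> M) : Prop := f 1%g = 0.

Definition cobound1 (M : lmodType R) (act : G -> M -> M) (f : G -> M) (x y : G) : M :=
  act x (f y) - f (x * y)%g + f x.

(* The Alexander-Whitney cup product; [act] is the action on the coefficients N. *)
Definition cup11 (M N : lmodType R) (act : G -> N -> N) (f : G -> M) (g : G -> N)
    (x y : G) : tensor M N :=
  tens (f x) (act x (g y)).
End Cochains.

Section HomComp.
Variables (R : comPzRingType) (A B C : lmodType R).

Lemma hom_comp_bilin :
  bilin (fun u : {linear B -> C} * {linear A -> B} => u.1 \o u.2 : {linear A -> C}).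
Proof.
by split=> [g a f f'|f a g g'] /=; apply: lin_eq => x //=; rewrite linearP.
Qed.

Definition hom_comp :
    {linear tensor {linear B -> C} {linear A -> B} -> {linear A -> C}} :=
  tensor_lin (b := fun (f : {linear B -> C}) (g : {linear A -> B}) =>
                     f \o g : {linear A -> C}) hom_comp_bilin.
End HomComp.
Arguments hom_comp {R A B C}.

(* f (x) 1 + 1 (x) f : H (x) H -> H^{(x)3} *)
Definition tens_deriv (R : comPzRingType) (H : lmodType R)
    (f : {linear H -> tpow H 2}) : {linear tpow H 2 -> tpow H 3} :=
  (tens11 (p := 2) (q := 1) f idfun : {linear tpow H 2 -> tpow H 3})
  + (tens11 (p := 1) (q := 2) idfun f : {linear tpow H 2 -> tpow H 3}).

(* Main.v *)
(* Put theta_m for the degree m component of theta.  If U lies in IA, then U acts on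
   an element a with components a_m by
     (U a)_2 = a_2 + u_1 a_1,
     (U a)_3 = a_3 + (u_1 (x) 1 + 1 (x) u_1) a_2 + u_2 a_1,
   so theta o phi = tau(phi) o |phi| o theta expresses theta_2 (phi a) and
   theta_3 (phi a) through theta_2 a, theta_3 a and the Johnson maps.  Computing
   theta_m (phi (psi a)) for m = 2, 3 in two ways gives both cocycle formulas.

   This uses only that tau(phi) exists.  Given a basis x_i of F, each Magnus
   expansion theta yields the continuous algebra automorphism L_theta with
   L_theta [x_i] = theta x_i - 1; it is unipotent for the degree filtration, hence
   lies in IA, and L_theta' o L_theta^-1 carries theta to theta', since the two
   multiplicative maps agree on the basis. *)
Require Import Defs.
From HB Require Import structures.
From mathcomp Require Import all_boot all_algebra.
From mathcomp Require Import boolp classical_sets.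
Set Implicit Arguments.
Unset Strict Implicit.
Unset Printing Implicit Defensive.
Import GRing.Theory.
Local Open Scope ring_scope.

(** * Products on tensor powers and on the completed tensor algebra *)

Section CompletedTensorAlgebra.
Variables (R : comPzRingType) (H : lmodType R).
Implicit Types (h : H) (a b c : That H) (p q m : nat) (f g : {linear H -> H}).

Lemma That_eqP a b : (forall m, a m = b m) -> a = b.
Proof. exact: functional_extensionality_dep. Qed.

Lemma ThatD a b m : (a + b) m = a m + b m. Proof. by []. Qed.
Lemma ThatB a b m : (a - b) m = a m - b m. Proof. by []. Qed.
Lemma ThatZ (r : R) a m : (r *: a) m = r *: a m. Proof. by []. Qed.
Lemma That_sumE (I : Type) (s : seq I) (P : pred I) (F : I -> That H) m :
  (\sum_(i <- s | P i) F i) m = \sum_(i <- s | P i) F i m.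
Proof. exact: (linear_sum (That_comp m)). Qed.

Lemma hmul_linear h m : linear (@hmul R H h m).
Proof. by have [_ Br] := hmul_bilin H m; exact: Br. Qed.
HB.instance Definition _ h m :=
  GRing.isLinear.Build R (tpow H m) (tpow H m.+1) *:%R (@hmul R H h m)
    (@hmul_linear h m).

Lemma hmulPl m (t : tpow H m) (r : R) h h' :
  hmul (r *: h + h') t = r *: hmul h t + hmul h' t.
Proof. by have [Bl _] := hmul_bilin H m; exact: Bl. Qed.

Lemma hmulZl m (t : tpow H m) (r : R) h : hmul (r *: h) t = r *: hmul h t.
Proof.
have hmul0l : hmul 0 t = 0.
  by have := hmulPl t (-1) 0 0; rewrite scaler0 addr0 scaleN1r addNr.
by have := hmulPl t r h 0; rewrite addr0 hmul0l addr0.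
Qed.

Lemma tmul_linear q (t : tpow H q) p : linear (@tmul R H q t p).
Proof. by have [Bl _] := tmul_bilin H p q; exact: Bl. Qed.
HB.instance Definition _ q (t : tpow H q) p :=
  GRing.isLinear.Build R (tpow H p) (tpow H (p + q)) *:%R (@tmul R H q t p)
    (@tmul_linear q t p).

Lemma tmulPl p q (s : tpow H p) (r : R) (t t' : tpow H q) :
  tmul (r *: t + t') s = r *: tmul t s + tmul t' s.
Proof. by have [_ Br] := tmul_bilin H p q; exact: Br. Qed.

Lemma tmul_hmul p q (t : tpow H q) h (s : tpow H p) :
  tmul t (hmul h s) = hmul h (tmul t s) :> tpow H (p.+1 + q).
Proof.
case: p s => [|p] s /=.
  by rewrite hmulZl [RHS](linearZ_LR (@hmul R H h q)).
have [Bl Br] := hmul_bilin H (p.+1 + q).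
have Cb : bilin (fun u : H * tpow H p.+1 => hmul u.1 (tmul t u.2)).
  split=> [y r x x'|x r y y']; first exact: (Bl (@tmul R H q t p.+1 y)).
  rewrite [LHS](congr1 (@hmul R H x _) (@tmul_linear q t p.+1 r y y')).
  exact: Br.
exact: (univ_lift_gen (h, s) Cb).
Qed.

(** Words [h_1 ... h_m] generate [tpow H m] additively, because a coefficient can be absorbed into
    the first letter. *)
Lemma tpow_ind (P : forall m, tpow H m -> Prop) :
  (forall r : R, P 0%N r) ->
  (forall m (s t : tpow H m), P m s -> P m t -> P m (s + t)) ->
  (forall m h (s : tpow H m), P m s -> P m.+1 (hmul h s)) ->
  forall m (t : tpow H m), P m t.
Proof.
move=> P0 PD PM; elim=> [|m IHm] //.
case: m IHm => [|m] IHm t.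
  by rewrite -[t]scale1r; exact: (PM 0%N t (1 : R)).
rewrite (univ_genE t).
elim: (repr t) => [|[r [h s]] l IHl].
  rewrite big_nil -(linear0 (@hmul R H 0 m.+1)).
  exact: (PM m.+1 0 0 (IHm 0)).
rewrite big_cons; apply: PD IHl.
exact: (eq_rect _ (P m.+2) (PM m.+1 (r *: h) s (IHm s)) _ (@hmulZl m.+1 s r h)).
Qed.

Lemma tpow_map_hmul f m h (t : tpow H m) :
  tpow_map f m.+1 (hmul h t) = hmul (f h) (tpow_map f m t).
Proof.
case: m t => [|m] t /=; first by rewrite linearZ.
exact: (univ_lift_gen (h, t) (tensor_map_bilin f (tpow_map f m.+1))).
Qed.

Lemma tpow_map_tmul f p q (s : tpow H p) (t : tpow H q) :
  tpow_map f (p + q) (tmul t s) = tmul (tpow_map f q t) (tpow_map f p s).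
Proof.
move: p s; apply: tpow_ind => [r|p s s' IHs IHs'|p h s IHs].
- exact: (linearZ_LR (tpow_map f q)).
- by rewrite !linearD IHs IHs'.
by rewrite tmul_hmul !tpow_map_hmul tmul_hmul IHs.
Qed.

Lemma tpow_map_id f : (forall h, f h = h) ->
  forall m (t : tpow H m), tpow_map f m t = t.
Proof.
move=> fE; apply: tpow_ind => [r|m s t IHs IHt|m h s IHs] //.
  by rewrite linearD IHs IHt.
by rewrite tpow_map_hmul fE IHs.
Qed.

Lemma tpow_map_comp f g (e : {linear H -> H}) : (forall h, f (g h) = e h) ->
  forall m (t : tpow H m), tpow_map f m (tpow_map g m t) = tpow_map e m t.
Proof.
move=> fg; apply: tpow_ind => [r|m s t IHs IHt|m h s IHs] //.
  by rewrite !linearD IHs IHt.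
by rewrite !tpow_map_hmul fg IHs.
Qed.

(* Left multiplication by h; unlike That_mul it involves no cast. *)
Definition shift h a : That H :=
  fun m => match m return tpow H m with 0 => 0 | m'.+1 => hmul h (a m') end.

Lemma shift_linear h : linear (shift h).
Proof.
move=> r a b; apply: That_eqP => -[|m].
  by rewrite /= ThatD ThatZ /= scaler0 addr0.
by rewrite ThatD ThatZ /= -linearP.
Qed.
HB.instance Definition _ h :=
  GRing.isLinear.Build R (That H) (That H) *:%R (shift h) (shift_linear h).

Lemma ecast_tpow_linear m m' (e : m = m') :
  linear (fun t : tpow H m => ecast k (tpow H k) e t).
Proof. by case: _ / e. Qed.

Lemma ecast_tpow0 m m' (e : m = m') : ecast k (tpow H k) e 0 = 0.
Proof. by case: _ / e. Qed.

Lemma That_mul_linearl b : linear ((@That_mul R H)^~ b).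
Proof.
move=> r a a'; apply: That_eqP => m.
rewrite ThatD ThatZ /That_mul scaler_sumr -big_split.
apply: eq_bigr => i _; rewrite -[RHS]ecast_tpow_linear.
by congr (ecast k _ _ _); rewrite -linearP.
Qed.

Lemma That_mul_linearr a : linear (@That_mul R H a).
Proof.
move=> r b b'; apply: That_eqP => m.
rewrite ThatD ThatZ /That_mul scaler_sumr -big_split.
apply: eq_bigr => i _; rewrite -[RHS]ecast_tpow_linear.
by congr (ecast k _ _ _); rewrite -tmulPl.
Qed.
HB.instance Definition _ a :=
  GRing.isLinear.Build R (That H) (That H) *:%R (That_mul a)
    (That_mul_linearr a).

(** A separate name lets right multiplication carry its own linear structure. *)
Definition That_mulr b a := That_mul a b.
HB.instance Definition _ b :=
  GRing.isLinear.Build R (That H) (That H) *:%R (That_mulr b)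
    (That_mul_linearl b).

Lemma ecast_hmul h m m' (e : m = m') (e' : m.+1 = m'.+1) (t : tpow H m) :
  ecast k (tpow H k) e' (hmul h t) = hmul h (ecast k (tpow H k) e t).
Proof. by case: _ / e e' => e'; rewrite eq_axiomK. Qed.

Lemma shift_mul h a b : That_mul (shift h a) b = shift h (That_mul a b).
Proof.
apply: That_eqP => -[|m].
  rewrite /That_mul big_ord1 /= scale0r.
  by rewrite eq_axiomK.
(* The summand [i = 0] vanishes since [shift h a] has no constant term; the others match those of
   the product in degree [m], up to the proofs used in the casts. *)
rewrite /That_mul big_ord_recl /= scale0r.
rewrite linear_sum /=.
rewrite ecast_tpow0 add0r; apply: eq_bigr => i _.
have ei := subnKC (leq_ord i).
rewrite -(ecast_hmul h _ (f_equal succn (subnKC (leq_ord i)))) /=.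
rewrite -tmul_hmul.
set e1 := subnKC _; set e2 := f_equal _ _.
by rewrite (eq_irrelevance e1 e2).
Qed.

Lemma That_mul1 b : That_mul (That_one H) b = b.
Proof.
apply: That_eqP => m; rewrite /That_mul big_ord_recl big1 ?addr0 => [|i _].
  move: (subnKC _); rewrite /= subn0 => e.
  by rewrite eq_axiomK /= scale1r.
have -> : That_one H (lift ord0 i) = 0 by [].
by rewrite linear0 ecast_tpow0.
Qed.

Lemma tmul0l p q (s : tpow H p) : tmul (0 : tpow H q) s = 0.
Proof.
by have := tmulPl s (-1) (0 : tpow H q) 0; rewrite scaler0 addr0 scaleN1r addNr.
Qed.

(** * The degree filtration and homogeneous elements *)

Lemma That_geD p a b : That_ge p a -> That_ge p b -> That_ge p (a + b).
Proof. by move=> pa pb m mp; rewrite ThatD pa // pb // addr0. Qed.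

Lemma That_geZ p (r : R) a : That_ge p a -> That_ge p (r *: a).
Proof. by move=> pa m mp; rewrite ThatZ pa // scaler0. Qed.

Lemma That_geN p a : That_ge p a -> That_ge p (- a).
Proof. by rewrite -scaleN1r; exact: That_geZ. Qed.

Lemma That_geB p a b : That_ge p a -> That_ge p b -> That_ge p (a - b).
Proof. by move=> pa pb; apply: That_geD => //; exact: That_geN. Qed.

Lemma That_geW p q a : (p <= q)%N -> That_ge q a -> That_ge p a.
Proof. by move=> pq qa m mp; apply: qa; exact: leq_trans pq. Qed.

Lemma That_ge_congr m a b : That_ge m.+1 (a - b) -> a m = b m.
Proof. by move=> /(_ m (ltnSn m))/eqP; rewrite ThatB subr_eq0 => /eqP. Qed.

Lemma That_ge_eq a b : (forall p, That_ge p (a - b)) -> a = b.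
Proof. by move=> ab; apply: That_eqP => m; exact: That_ge_congr. Qed.

Lemma That_ge_shift p h a : That_ge p a -> That_ge p.+1 (shift h a).
Proof. by move=> pa [|m] //= mp; rewrite pa // linear0. Qed.

Lemma That_ge_mul p q a b :
  That_ge p a -> That_ge q b -> That_ge (p + q) (That_mul a b).
Proof.
move=> pa qb m mpq; rewrite /That_mul big1 // => i _.
case: (ltnP i p) => ip; first by rewrite pa // linear0 ecast_tpow0.
rewrite qb ?tmul0l ?ecast_tpow0 // ltn_subLR ?(leq_ord i) //.
by apply: leq_trans mpq _; rewrite leq_add2r.
Qed.

(** The inclusion of the degree [m] factor; the proof of [m = j] found by [eqP] supplies the
    transport. *)
Definition homog m (t : tpow H m) : That H := fun j =>
  match @eqP _ m j with
  | ReflectT e => ecast i (tpow H i) e t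
  | ReflectF _ => 0
  end.

Lemma homog_id m (t : tpow H m) : homog t m = t.
Proof. by rewrite /homog; case: eqP => // e; rewrite eq_axiomK. Qed.

Lemma homog_neq m (t : tpow H m) j : m != j -> homog t j = 0.
Proof. by rewrite /homog; case: eqP. Qed.

Lemma homog_linear m : linear (@homog m).
Proof.
move=> r s t; apply: That_eqP => j; rewrite ThatD ThatZ /homog.
by case: eqP => e; [rewrite ecast_tpow_linear | rewrite scaler0 addr0].
Qed.
HB.instance Definition _ m :=
  GRing.isLinear.Build R (tpow H m) (That H) *:%R (@homog m) (@homog_linear m).

Lemma homog_hmul m h (s : tpow H m) : homog (hmul h s) = shift h (homog s).
Proof.
apply: That_eqP => -[|j]; first exact: homog_neq.
rewrite /= /homog.
case: (@eqP _ m.+1 j.+1) => [e'|ne]; case: (@eqP _ m j) => [e|ne'].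
- exact: ecast_hmul.
- by case: ne'; case: e'.
- by case: ne; rewrite e.
by rewrite linear0.
Qed.

Lemma homog_scalar (r : tpow H 0) : homog r = (r : R) *: That_one H.
Proof.
apply: That_eqP => -[|j]; first by rewrite homog_id ThatZ /= [RHS]mulr1.
by rewrite homog_neq // ThatZ /= scaler0.
Qed.

Lemma That_trunc p a : That_ge p (a - \sum_(i < p) homog (a i)).
Proof.
move=> m mp; rewrite ThatB That_sumE (bigD1 (Ordinal mp)) //= homog_id.
rewrite big1 ?addr0 ?subrr // => i /eqP im; rewrite homog_neq //.
by apply/eqP => e; apply: im; exact: val_inj.
Qed.

(* Two continuous linear maps are compared by induction on words in H; applied in
   the left variable, this gives associativity and all multiplicativity claims. *)
Lemma That_ext (f g : {linear That H -> That H}) :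
  (forall p a, That_ge p a -> That_ge p (f a)) ->
  (forall p a, That_ge p a -> That_ge p (g a)) ->
  f (That_one H) = g (That_one H) ->
  (forall h a, f a = g a -> f (shift h a) = g (shift h a)) -> f =1 g.
Proof.
move=> ff gf fg1 fgS.
have fgH : forall m (t : tpow H m), f (homog t) = g (homog t).
  apply: tpow_ind => [r|m s t fgs fgt|m h s fgs].
  - by rewrite homog_scalar !linearZ_LR fg1.
  - by rewrite !linearD fgs fgt.
  by rewrite homog_hmul; exact: fgS.
move=> a; apply: That_ge_eq => p; set s := \sum_(i < p) homog (a i).
have fgs : f s = g s by rewrite !linear_sum; apply: eq_bigr.
have -> : f a - g a = f (a - s) - g (a - s).
  by rewrite !linearB fgs /= opprK addrACA addNr addr0.
by apply: That_geB; [apply: ff | apply: gf]; exact: That_trunc.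
Qed.

(** * Algebra laws, and the algebra maps induced by endomorphisms of [H] *)

Lemma That_mulA a b c : That_mul a (That_mul b c) = That_mul (That_mul a b) c.
Proof.
apply/esym; apply: (That_ext (f := That_mulr c \o That_mulr b)
  (g := That_mulr (That_mul b c))) => /=; rewrite /That_mulr.
(* Writing [p] as [p + 0 + 0] lets [That_ge_mul] apply with [b] and [c] in [That_ge 0], which is
   everything. *)
- move=> p x px; rewrite -[p]addn0 -[p]addn0.
  by do 2 apply: That_ge_mul => //.
- by move=> p x px; rewrite -[p]addn0; apply: That_ge_mul.
- by rewrite !That_mul1.
by move=> h x e; rewrite !shift_mul e.
Qed.

Lemma That_mulr1 a : That_mul a (That_one H) = a.
Proof.
apply: (That_ext (f := That_mulr (That_one H)) (g := idfun)) => //=;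
  rewrite /That_mulr.
- by move=> p x px; rewrite -[p]addn0; apply: That_ge_mul.
- by rewrite That_mul1.
by move=> h x e; rewrite shift_mul e.
Qed.

Lemma shift1 h : shift h (That_one H) = That_H h.
Proof.
apply: That_eqP => -[|[|m]] //=; first by rewrite scale1r.
exact: (linear0 (@hmul R H h m.+1)).
Qed.

Lemma That_mul_H h a : That_mul (That_H h) a = shift h a.
Proof. by rewrite -shift1 shift_mul That_mul1. Qed.

Lemma That_map_linear f : linear (That_map f).
Proof. by move=> r a b; apply: That_eqP => m; rewrite /That_map linearP. Qed.
HB.instance Definition _ f :=
  GRing.isLinear.Build R (That H) (That H) *:%R (That_map f) (That_map_linear f).

Lemma That_map_ge f p a : That_ge p a -> That_ge p (That_map f a).
Proof. by move=> pa m mp; rewrite /That_map pa // linear0. Qed.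

Lemma That_map_shift f h a : That_map f (shift h a) = shift (f h) (That_map f a).
Proof.
apply: That_eqP => -[|m]; first by rewrite /That_map /= .
exact: tpow_map_hmul.
Qed.

Lemma That_map_one f : That_map f (That_one H) = That_one H.
Proof. by apply: That_eqP => -[|m] //; rewrite /That_map linear0. Qed.

Lemma That_map_mul f a b :
  That_map f (That_mul a b) = That_mul (That_map f a) (That_map f b).
Proof.
apply: (That_ext (f := That_map f \o That_mulr b)
  (g := That_mulr (That_map f b) \o That_map f)) => /=; rewrite /That_mulr.
- move=> p x px; apply: That_map_ge; rewrite -[p]addn0.
  exact: That_ge_mul.
- move=> p x px; rewrite -[p]addn0; apply: That_ge_mul => //.
  exact: That_map_ge.
- by rewrite That_map_one !That_mul1.
by move=> h x e; rewrite That_map_shift !shift_mul That_map_shift e.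
Qed.


(** * Extension of a linear map on [H] to a continuous algebra endomorphism *)

Section Extension.
Variable f : {linear H -> That H}.

Lemma tpow_lift_bilin m (g : {linear tpow H m.+1 -> That H}) :
  bilin (fun u : H * tpow H m.+1 => That_mul (f u.1) (g u.2)).
Proof.
split=> [t r h h'|h r t t'] /=; last by rewrite !linearP.
by rewrite linearP; exact: That_mul_linearl.
Qed.

Lemma That_scalar_linear : linear (fun r : tpow H 0 => (r : R) *: That_one H).
Proof. by move=> r s t /=; rewrite scalerDl scalerA. Qed.

Definition That_scalar : {linear tpow H 0 -> That H} :=
  HB.pack (fun r : tpow H 0 => (r : R) *: That_one H)
    (GRing.isLinear.Build R (tpow H 0) (That H) *:%R _ That_scalar_linear).

(** Sends a word [h_1 ... h_m] to the product of the [f h_i]; degree 1 is split off as in [tpow]. *)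
Fixpoint tpow_lift m : {linear tpow H m -> That H} :=
  match m return {linear tpow H m -> That H} with
  | 0 => That_scalar
  | m'.+1 =>
    match m' return {linear tpow H m' -> That H} ->
                    {linear tpow H m'.+1 -> That H} with
    | 0 => fun _ => f
    | _.+1 => fun fm => tensor_lin (b := fun h t => That_mul (f h) (fm t))
                          (tpow_lift_bilin fm)
    end (tpow_lift m')
  end.

Lemma tpow_lift_hmul m h (t : tpow H m) :
  tpow_lift m.+1 (hmul h t) = That_mul (f h) (tpow_lift m t).
Proof.
case: m t => [|m] t /=.
  by rewrite !linearZ_LR [X in _ = _ *: X](That_mulr1 (f h)).
exact: (univ_lift_gen (h, t) (tpow_lift_bilin (tpow_lift m.+1))).
Qed.

(** When [f] takes values in [That_ge 1], words of length [m > j] contribute nothing in degree [j],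
    so stopping at [m = j] gives the full infinite sum. *)
Definition That_lift a : That H :=
  fun j => \sum_(m < j.+1) tpow_lift m (a m) j.

Lemma That_lift_linear : linear That_lift.
Proof.
move=> r a b; apply: That_eqP => j.
rewrite ThatD ThatZ /That_lift scaler_sumr -big_split.
by apply: eq_bigr => i _; rewrite ThatD ThatZ linearP.
Qed.
HB.instance Definition _ :=
  GRing.isLinear.Build R (That H) (That H) *:%R That_lift That_lift_linear.

Lemma That_lift_one : That_lift (That_one H) = That_one H.
Proof.
apply: That_eqP => j; rewrite /That_lift big_ord_recl big1 ?addr0 => [|i _].
  by rewrite [tpow_lift _ _](scale1r).
have -> : That_one H (lift ord0 i) = 0 by [].
by rewrite linear0.
Qed.

Hypothesis f_ge1 : forall h, That_ge 1 (f h).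

Lemma tpow_lift_ge m (t : tpow H m) : That_ge m (tpow_lift m t).
Proof.
move: m t; apply: tpow_ind => [r|m s t IHs IHt|m h s IHs] //.
  by rewrite linearD; exact: That_geD.
by rewrite tpow_lift_hmul -add1n; exact: That_ge_mul.
Qed.

Lemma That_lift_ge p a : That_ge p a -> That_ge p (That_lift a).
Proof.
move=> pa j jp; rewrite /That_lift big1 // => i _.
by rewrite pa ?linear0 // (leq_ltn_trans (leq_ord i)).
Qed.

Lemma That_lift_approx p a :
  That_ge p (That_lift a - \sum_(m < p) tpow_lift m (a m)).
Proof.
move=> j jp; rewrite ThatB That_sumE /That_lift.
rewrite (big_ord_widen p (fun m => tpow_lift m (a m) j)) // big_mkcond /=.
apply/eqP; rewrite subr_eq0; apply/eqP; apply: eq_bigr => i _.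
by case: ltnP => // ji; rewrite tpow_lift_ge.
Qed.

Lemma That_lift_shift h a :
  That_lift (shift h a) = That_mul (f h) (That_lift a).
Proof.
apply: That_eqP => j.
(* As [f h] starts in degree 1, degree [j] of the product sees only degrees below [j] of
   [That_lift a], where a finite sum of [j] terms suffices. *)
have := That_ge_mul (f_ge1 h) (That_lift_approx (p := j) a).
rewrite linearB => /That_ge_congr ->.
rewrite linear_sum That_sumE /That_lift big_ord_recl.
have -> : shift h a (@ord0 j) = 0 by [].
rewrite linear0 add0r; apply: eq_bigr => i _.
exact: (congr1 (fun x : That H => x j) (tpow_lift_hmul h (a i))).
Qed.

Lemma That_lift_H h : That_lift (That_H h) = f h.
Proof. by rewrite -shift1 That_lift_shift That_lift_one That_mulr1. Qed.

Lemma That_lift_mul a b :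
  That_lift (That_mul a b) = That_mul (That_lift a) (That_lift b).
Proof.
apply: (That_ext (f := That_lift \o That_mulr b)
  (g := That_mulr (That_lift b) \o That_lift)) => /=; rewrite /That_mulr.
- by move=> p x px; apply: That_lift_ge; rewrite -[p]addn0; exact: That_ge_mul.
- move=> p x px; rewrite -[p]addn0; apply: That_ge_mul => //.
  exact: That_lift_ge.
- by rewrite That_lift_one !That_mul1.
by move=> h x e; rewrite shift_mul !That_lift_shift e That_mulA.
Qed.

Hypothesis f_ge2 : forall h, That_ge 2 (f h - That_H h).

Lemma tpow_lift_homog m (t : tpow H m) : That_ge m.+1 (tpow_lift m t - homog t).
Proof.
move: m t; apply: tpow_ind => [r|m s t IHs IHt|m h s IHs].
- by rewrite homog_scalar subrr.
- by rewrite !linearD addrACA; exact: That_geD.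
rewrite tpow_lift_hmul homog_hmul -That_mul_H.
(* Telescoping: the first summand has order [2 + m], the second [1 + m.+1]. *)
have -> : That_mul (f h) (tpow_lift m s) - That_mul (That_H h) (homog s) =
    That_mulr (tpow_lift m s) (f h - That_H h) +
    That_mul (That_H h) (tpow_lift m s - homog s).
  by rewrite !linearB /= addrA addrNK.
apply: That_geD; last first.
  by rewrite That_mul_H; exact: That_ge_shift.
by rewrite -add2n; apply: That_ge_mul => //; exact: tpow_lift_ge.
Qed.

(** In degree [j <= p] only the summand [m = j] survives, and by [tpow_lift_homog] its lowest part
    is [a j]. *)
Lemma That_lift_unipotent p a : That_ge p a -> That_ge p.+1 (That_lift a - a).
Proof.
move=> pa j; rewrite ltnS => jp; rewrite ThatB /That_lift big_ord_recr /=.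
rewrite big1 ?add0r => [|i _]; last first.
  by rewrite pa ?linear0 // (leq_trans (ltn_ord i)).
move: (@tpow_lift_homog j (a j) j (ltnSn j)).
by rewrite ThatB homog_id.
Qed.

End Extension.

(** * Maps that are unipotent for the degree filtration *)

Section Unipotent.
Variable A : {linear That H -> That H}.
Hypothesis A_unip : forall p a, That_ge p a -> That_ge p.+1 (A a - a).

Lemma unipotent_ge p a : That_ge p a -> That_ge p (A a).
Proof.
move=> pa; rewrite -[A a](addrNK a); apply: That_geD => //.
by apply: That_geW (A_unip pa).
Qed.

(** Induction on the degree: once [a] lies in [That_ge p], the correction [A a - a] already lies in
    [That_ge p.+1]. *)
Lemma unipotent_ge_inv p a : That_ge p (A a) -> That_ge p a.
Proof.
move=> pAa; elim: p => // p IHp in pAa *.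
have pa : That_ge p a by apply: IHp; exact: That_geW pAa.
have -> : a = A a - (A a - a) by rewrite opprB addrCA subrr addr0.
by apply: That_geB => //; exact: A_unip.
Qed.

Lemma unipotent_inj : injective A.
Proof.
move=> a b ab; apply: That_ge_eq => p; apply: unipotent_ge_inv.
by rewrite linearB ab subrr.
Qed.

Lemma unipotent_surj b : exists a, A a = b.
Proof.
pose N a : That H := a - A a.
have Nb j : That_ge j (iter j N b).
  elim: j => //= j IHj; rewrite /N -opprB; apply: That_geN; exact: A_unip.
(* the Neumann series for the inverse of A = 1 - N *)
pose S j := \sum_(i < j) iter i N b.
have AS j : A (S j) = b - iter j N b.
  elim: j => [|j IHj]; first by rewrite /S big_ord0 linear0 subrr.
  rewrite /S big_ord_recr linearD /= -/(S j) IHj /N opprB -addrA.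
  by congr (_ + _); rewrite addrC.
(* Degree [j] of the series is settled by the terms of index at most [j], since [iter i N b] lies in
   [That_ge i]. *)
exists (fun j => S j.+1 j) => /=; set a : That H := fun j => S j.+1 j.
apply: That_ge_eq => p.
have aS : That_ge p (a - S p).
  move=> j jp; rewrite ThatB /a /S !That_sumE.
  rewrite (big_ord_widen p (fun i => iter i N b j)) // big_mkcond /=.
  apply/eqP; rewrite subr_eq0; apply/eqP; apply: eq_bigr => i _.
  by case: ltnP => // ji; rewrite Nb.
(* Splitting off the partial sum [S p] leaves two terms of order at least [p]. *)
have -> : A a - b = A (a - S p) - iter p N b.
  by rewrite linearB AS /= opprB addrA addrAC addrK.
by apply: That_geB => //; exact: unipotent_ge.
Qed.

Lemma unipotent_bij : bijective A.
Proof.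
have [B BK] := choice unipotent_surj.
by exists B => // a; apply: unipotent_inj; rewrite BK.
Qed.

Lemma unipotent_in_IA :
  A (That_one H) = That_one H ->
  (forall a b, A (That_mul a b) = That_mul (A a) (A b)) -> in_IA A.
Proof.
move=> A1 AM; split=> //; first exact: unipotent_bij; last exact: A_unip.
move=> p _; apply/seteqP; split=> [_ [a pa <-]|b pb].
  exact: unipotent_ge.
have [a ab] := unipotent_surj b; exists a => //.
by apply: unipotent_ge_inv; rewrite ab.
Qed.

End Unipotent.

(** * Construction of elements of IA, closure under composition and inverse, and their determination
    on [H] *)

Lemma That_H_ge1 h : That_ge 1 (That_H h).
Proof. by case. Qed.

Lemma That_ge1_congr h a : That_ge 2 (a - That_H h) -> That_ge 1 a.
Proof.
move=> ah2; rewrite -[a](addrNK (That_H h)); apply: That_geD (That_H_ge1 h).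
exact: That_geW ah2.
Qed.

Lemma That_lift_in_IA (f : {linear H -> That H}) :
  (forall h, That_ge 2 (f h - That_H h)) -> in_IA (That_lift f).
Proof.
move=> f2.
have f1 h : That_ge 1 (f h) by exact: That_ge1_congr (f2 h).
apply: unipotent_in_IA; first exact: That_lift_unipotent.
  exact: That_lift_one.
exact: That_lift_mul.
Qed.

Lemma in_IA_comp (U V : {linear That H -> That H}) :
  in_IA U -> in_IA V -> in_IA (U \o V).
Proof.
move=> iU iV; split=> [||a b|p p1|a a1] /=.
- by apply: bij_comp; exact: IA_bij.
- by rewrite (IA_one iV) (IA_one iU).
- by rewrite (IA_mul iV) (IA_mul iU).
- by rewrite -(image_comp V U) (IA_filt iV) // (IA_filt iU).
have Va1 : That_ge 1 (V a) by rewrite -(IA_filt iV (leqnn 1)); exists a.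
rewrite -[U _](addrNK (V a)) -addrA; apply: That_geD.
  exact: (IA_id iU).
exact: (IA_id iV).
Qed.

Lemma in_IA_inv (U : {linear That H -> That H}) :
  in_IA U -> exists2 V : {linear That H -> That H}, in_IA V & cancel U V.
Proof.
move=> iU; have [V UK VK] := IA_bij iU.
have U_inj := can_inj UK.
have V_lin : linear V by move=> r a b; apply: U_inj; rewrite linearP !VK.
pose W : {linear That H -> That H} :=
  HB.pack V (GRing.isLinear.Build R (That H) (That H) *:%R V V_lin).
have Wfilt p : (1 <= p)%N -> image (That_ge p) W = That_ge p.
  move=> p1; rewrite -{1}(IA_filt iU p1) image_comp; apply/seteqP.
  by split=> [_ [a pa <-] /=|a pa]; [rewrite UK | exists a; rewrite //= UK].
exists W => //; split=> [|||//|a a1].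
- by exists U.
- by apply: U_inj; rewrite /= VK (IA_one iU).
- by move=> a b; apply: U_inj; rewrite (IA_mul iU) /= !VK.
have Wa1 : That_ge 1 (W a) by rewrite -(Wfilt 1%N isT); exists a.
(* With [b = W a], the difference [W a - a] is the opposite of [U b - b]. *)
by rewrite -opprB; apply: That_geN; have := IA_id iU Wa1; rewrite /= VK.
Qed.


Lemma in_IA_ge (U : {linear That H -> That H}) p a :
  in_IA U -> That_ge p a -> That_ge p (U a).
Proof.
case: p => [|p] iU pa; first by [].
by rewrite -(IA_filt iU (ltn0Sn p)); exists a.
Qed.

(** Multiplicativity and continuity determine [U] from its restriction to [H]; this is the
    injectivity of [E_IA], and makes [U] computable degree by degree. *)
Lemma in_IA_lift (U : {linear That H -> That H}) :
  in_IA U -> forall a, U a = That_lift (U \o That_H (H := H)) a.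
Proof.
move=> iU; apply: That_ext => [p a|p a||h a e].
- exact: in_IA_ge.
- exact: That_lift_ge.
- by rewrite (IA_one iU) /= That_lift_one.
rewrite /= That_lift_shift -?e -?That_mul_H ?(IA_mul iU) // => h'.
exact/in_IA_ge/That_H_ge1.
Qed.

(** * Action of an element of IA in degrees 2 and 3 *)

Section LowDegree.
Variable U : {linear That H -> That H}.
Hypothesis iU : in_IA U.
Let f : {linear H -> That H} := U \o That_H (H := H).

Let f_ge1 h : That_ge 1 (f h).
Proof. exact/in_IA_ge/That_H_ge1. Qed.

Let f_ge2 h : That_ge 2 (f h - That_H h).
Proof. exact/(IA_id iU)/That_H_ge1. Qed.

Let f_0 h : f h 0 = 0. Proof. exact: f_ge1. Qed.

Let f_1 h : f h 1 = h.
Proof. by have := f_ge2 h; move/That_ge_congr. Qed.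

(** For [U = total_johnson theta phi], [E1] and [E2] are the first two Johnson maps of [phi]. *)
Let E1 : {linear H -> tpow H 2} := That_comp 2 \o E_IA U.
Let E2 : {linear H -> tpow H 3} := That_comp 3 \o E_IA U.

Let E1E h : E1 h = f h 2.
Proof. by rewrite /E1 /= /That_comp ThatB subr0. Qed.

Let E2E h : E2 h = f h 3.
Proof. by rewrite /E2 /= /That_comp ThatB subr0. Qed.

Lemma tens_deriv_tens (g : {linear H -> tpow H 2}) h h' :
  tens_deriv g (tens h h' : tpow H 2) =
  tmul (h' : tpow H 1) (g h) + tmul (g h') (h : tpow H 1).
Proof.
congr (_ + _).
  exact: (univ_lift_gen (h, h') (tens11_bilin (p := 2) (q := 1) g idfun)).
exact: (univ_lift_gen (h, h') (tens11_bilin (p := 1) (q := 2) idfun g)).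
Qed.

Lemma tpow_lift_top m (t : tpow H m) : tpow_lift f m t m = t.
Proof.
by rewrite (That_ge_congr (tpow_lift_homog f_ge1 f_ge2 t)) homog_id.
Qed.

(** On a word [h h'], degree 3 of the product of [f h] and [f h'] comes from the splittings 1 + 2
    and 2 + 1 only, since both factors start in degree 1, with leading parts [h] and [h']. *)
Lemma tpow_lift2_3 (t : tpow H 2) : tpow_lift f 2 t 3 = tens_deriv E1 t.
Proof.
apply: (univ_ext (f := That_comp 3 \o tpow_lift f 2) (g := tens_deriv E1)).
case=> h h'; rewrite [RHS](tens_deriv_tens E1 h h') !E1E.
rewrite [LHS](congr1 (fun x : That H => x 3)
  (tpow_lift_hmul f h (h' : tpow H 1))).
rewrite /That_mul !big_ord_recl big_ord0 addr0.
rewrite (f_0 h) linear0 ecast_tpow0 add0r addrC; congr (_ + _); last first.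
  rewrite [X in ecast k _ X _]eq_axiomK.
  exact: (congr1 (fun z : tpow H 1 => tmul (f h' 2) z) (f_1 h)).
rewrite [X in _ + X](_ : _ = 0) ?addr0.
  rewrite [X in ecast k _ X _]eq_axiomK.
  exact: (congr1 (fun z : tpow H 1 => tmul z (f h 2)) (f_1 h')).
by rewrite [X in tmul X](_ : _ = 0) ?tmul0l ?ecast_tpow0.
Qed.

Lemma in_IA_deg2 a : U a 2 = a 2 + E1 (a 1).
Proof.
rewrite (in_IA_lift iU) /That_lift !big_ord_recl big_ord0.
(* The summand [m = 0] is a multiple of [That_one], hence zero in degree 2. *)
rewrite [X in X + _](_ : _ = 0) ?add0r ?addr0; last exact: scaler0.
rewrite addrC; congr (_ + _); first exact: tpow_lift_top.
by rewrite E1E.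
Qed.

Lemma in_IA_deg3 a : U a 3 = a 3 + tens_deriv E1 (a 2) + E2 (a 1).
Proof.
rewrite (in_IA_lift iU) /That_lift !big_ord_recl big_ord0.
rewrite [X in X + _](_ : _ = 0) ?add0r ?addr0; last exact: scaler0.
rewrite addrC; congr (_ + _); last by rewrite E2E.
rewrite addrC; congr (_ + _); first exact: tpow_lift_top.
exact: tpow_lift2_3.
Qed.

End LowDegree.

End CompletedTensorAlgebra.

(** * Free groups, and transitivity of IA on Magnus expansions *)

Section FreeGroups.
Variables (I : Type) (F : groupType) (x : I -> F).
Hypothesis Fx : free_basis x.

(** The elements satisfying [P] form a group [K]. The universal property gives a homomorphism from
    [F] to [K] that fixes the basis; composed with the inclusion it is the identity by
    uniqueness. *)
Lemma free_basis_ind (P : F -> Prop) :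
  P 1%g -> (forall a b, P a -> P b -> P (a * b)%g) ->
  (forall a, P a -> P (a^-1)%g) -> (forall i, P (x i)) -> forall a, P a.
Proof.
move=> P1 PM PV Px.
pose K := {a : F | `[< P a >]}.
pose K1 : K := exist _ 1%g (asboolT P1).
pose KM (a b : K) : K :=
  exist _ (val a * val b)%g (asboolT (PM _ _ (asboolW (valP a)) (asboolW (valP b)))).
pose KV (a : K) : K := exist _ ((val a)^-1)%g (asboolT (PV _ (asboolW (valP a)))).
have KMA : associative KM by move=> a b c; apply: val_inj; exact: mulgA.
have K1M : left_id K1 KM by move=> a; apply: val_inj; exact: mul1g.
have KM1 : right_id K1 KM by move=> a; apply: val_inj; exact: mulg1.
have KVM : left_inverse K1 KV KM by move=> a; apply: val_inj; exact: mulVg.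
have KMV : right_inverse K1 KV KM by move=> a; apply: val_inj; exact: mulgV.
pose G : groupType := HB.pack K (isGroup.Build K KMA K1M KM1 KVM KMV).
have [g [gx _]] := Fx (G := G) (fun i => exist _ (x i) (asboolT (Px i))).
have vgM : {morph (fun a => val (g a : K)) : a b / (a * b)%g}.
  by move=> a b; rewrite gmulfM.
pose vg : {multiplicative F -> F} :=
  HB.pack (fun a => val (g a : K)) (isMultiplicative.Build F F _ vgM).
have idM : {morph (@id F) : a b / (a * b)%g} by [].
pose idF : {multiplicative F -> F} :=
  HB.pack (@id F) (isMultiplicative.Build F F _ idM).
have [h [_ h_uniq]] := Fx x.
move=> a; have <- : val (g a : K) = a.
  have -> : val (g a : K) = h a by apply: (h_uniq vg) => i /=; rewrite gx.
  by rewrite -(h_uniq idF).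
exact: asboolW (valP (g a : K)).
Qed.

(** The universal property is applied to the additive group of [V]. *)
Lemma free_basis_additive (V : zmodType) (f : I -> V) :
  exists2 g : F -> V, forall a b, g (a * b)%g = g a + g b & forall i, g (x i) = f i.
Proof.
pose G : groupType := HB.pack (Choice.sort V)
  (isGroup.Build (Choice.sort V) (@addrA V) (@add0r V) (@addr0 V) (@addNr V) (@addrN V)).
have [g [gx _]] := Fx (G := G) f.
by exists g => // a b; rewrite gmulfM.
Qed.

Variable R : comPzRingType.
Local Notation H := (H1 R F).

Lemma cls1 : cls R (1%g : F) = 0.
Proof. by apply: (addIr (cls R (1%g : F))); rewrite -clsM mul1g add0r. Qed.

Lemma clsV (a : F) : cls R (a^-1)%g = - cls R a.
Proof. by apply: (addIr (cls R a)); rewrite -clsM mulVg cls1 addNr. Qed.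

Lemma H1_basis_ind (P : H -> Prop) :
  P 0 -> (forall h h', P h -> P h' -> P (h + h')) ->
  (forall r h, P h -> P (r *: h)) -> (forall i, P (cls R (x i))) -> forall h, P h.
Proof.
move=> P0 PD PZ Px h; rewrite (univ_genE h).
apply: big_ind => // -[r a] _ /=; apply: (PZ r); move: a.
apply: free_basis_ind => //; first by rewrite -/(cls R 1%g) cls1.
- by move=> a b Pa Pb; rewrite -/(cls R (a * b)%g) clsM; exact: PD.
by move=> a Pa; rewrite -/(cls R (a^-1)%g) clsV -scaleN1r; exact: PZ.
Qed.

Lemma H1_basis_linear (V : lmodType R) (f : I -> V) :
  exists g : {linear H -> V}, forall i, g (cls R (x i)) = f i.
Proof.
have [g gM gx] := free_basis_additive f.
by exists (univ_lin (C := @H1_class R F) gM) => i; rewrite -gx; exact: univ_lift_gen.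
Qed.

(** The value at 1 is an idempotent [1 + u], so [u = - u u]; as [u] has order at least 1, this
    raises its order indefinitely. *)
Lemma magnus1 (theta : F -> That H) :
  magnus_expansion theta -> theta 1%g = That_one H.
Proof.
case=> thM /(_ 1%g) u1 _; set u := theta 1%g - That_one H in u1.
have uE : theta 1%g = u + That_one H by rewrite /u addrNK.
have uu : u = - That_mul u u.
  have e1 : That_mul u (theta 1%g) = 0.
    apply: (addIr (theta 1%g)); rewrite add0r -{2}(That_mul1 (theta 1%g)).
    rewrite -[LHS](linearD (That_mulr (theta 1%g)) u (That_one H)) -uE.
    by have /esym := thM 1%g 1%g; rewrite mulg1.
  by apply/eqP; rewrite -addr_eq0 -{1}[u](That_mulr1 u) addrC -linearD -uE; apply/eqP.
suff u0 : u = 0 by rewrite uE u0 add0r.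
apply: That_ge_eq => -[//|p]; rewrite subr0; elim: p => // p IHp.
by rewrite uu; apply: That_geN; rewrite -add1n; exact: That_ge_mul.
Qed.

Lemma magnus_lift (theta : F -> That H) : magnus_expansion theta ->
  exists2 L : {linear That H -> That H}, in_IA L &
    forall i, L (That_one H + That_H (cls R (x i))) = theta (x i).
Proof.
move=> [_ th1 thc].
have [f fx] := H1_basis_linear (fun i => theta (x i) - That_one H).
have f2 h : That_ge 2 (f h - That_H h).
  (* The congruence is linear in [h], so it is enough to check the classes of the basis. *)
  apply: (H1_basis_ind (P := fun h => That_ge 2 (f h - That_H h))) => 
    [|h1 h2 p1 p2|r h1 p1|i].
  - by rewrite !linear0 addr0.
  - by rewrite !linearD addrACA; exact: That_geD.
  - by rewrite !linearZ_LR -scalerDr; exact: That_geZ.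
  by rewrite fx -addrA -opprD; exact: thc.
have f1 h : That_ge 1 (f h) by exact: That_ge1_congr (f2 h).
exists (That_lift f); first exact: That_lift_in_IA.
by move=> i; rewrite linearD /= That_lift_one That_lift_H // fx addrC addrNK.
Qed.

Lemma magnus_transitive (theta theta' : F -> That H) :
  magnus_expansion theta -> magnus_expansion theta' ->
  exists2 U : {linear That H -> That H}, in_IA U & forall a, U (theta a) = theta' a.
Proof.
move=> mth mth'.
have [L iL Lx] := magnus_lift mth; have [L' iL' L'x] := magnus_lift mth'.
have [V iV LK] := in_IA_inv iL.
pose U : {linear That H -> That H} := L' \o V.
have iU : in_IA U := in_IA_comp iL' iV.
exists U => //; apply: free_basis_ind => [|a b ea eb|a ea|i].
- by rewrite !magnus1 // (IA_one iU).
- by rewrite (magnusM mth) (IA_mul iU) ea eb (magnusM mth').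
(* Uniqueness of inverses: the factor 1 on the left is written as [theta' (a^-1)] times [theta' a],
   and [theta' a = U (theta a)] cancels [U (theta (a^-1))]. *)
- rewrite -[U _]That_mul1 -(magnus1 mth') -(mulVg a) (magnusM mth') -ea.
  rewrite -That_mulA -(IA_mul iU) -(magnusM mth) mulgV (magnus1 mth) (IA_one iU).
  exact: That_mulr1.
by rewrite /U /= -Lx LK L'x.
Qed.

End FreeGroups.

(** * Additivity and equivariance of [f (x) 1 + 1 (x) f] *)

Section TensDeriv.
Variables (R : comPzRingType) (H : lmodType R).

Lemma tens_derivD (f g : {linear H -> tpow H 2}) (t : tpow H 2) :
  tens_deriv (f + g) t = tens_deriv f t + tens_deriv g t.
Proof.
apply: (univ_ext (f := tens_deriv (f + g)) (g := tens_deriv f + tens_deriv g)).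
case=> h h'; rewrite [LHS](tens_deriv_tens (f + g) h h').
rewrite [RHS](congr2 +%R (tens_deriv_tens f h h') (tens_deriv_tens g h h')).
rewrite addrACA; congr (_ + _); first exact: (linearD (tmul (h' : tpow H 1) (p := 2))).
by have := tmulPl (h : tpow H 1) 1 (f h') (g h'); rewrite !scale1r.
Qed.

Lemma tens_deriv0 (t : tpow H 2) : tens_deriv (0 : {linear H -> tpow H 2}) t = 0.
Proof.
by apply: (addIr (tens_deriv (0 : {linear H -> tpow H 2}) t));
  rewrite -tens_derivD addr0 add0r.
Qed.

(** Used with [u = |phi|] and [g = hom_act 1 phi f], to move [|phi|] through the derivation. *)
Lemma tens_deriv_map (f g : {linear H -> tpow H 2}) (u : {linear H -> H}) :
  (forall h, g (u h) = tpow_map u 2 (f h)) -> forall t : tpow H 2,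
  tpow_map u 3 (tens_deriv f t) = tens_deriv g (tpow_map u 2 t).
Proof.
move=> gu; apply: (univ_ext (f := tpow_map u 3 \o tens_deriv f)
  (g := tens_deriv g \o tpow_map u 2)).
case=> h h'; rewrite [LHS](congr1 _ (tens_deriv_tens f h h')).
rewrite [RHS](congr1 _ (tpow_map_hmul u h (h' : tpow H 1))).
rewrite [RHS](tens_deriv_tens g (u h) (u h')) linearD !gu.
by congr (_ + _); [exact: (tpow_map_tmul u (f h) (h' : tpow H 1)) |
  exact: (tpow_map_tmul u (h : tpow H 1) (f h'))].
Qed.

End TensDeriv.

(** * The total Johnson map and the product formulas for its first two components *)

Section JohnsonMaps.
Variables (I : Type) (R : comPzRingType) (F : groupType) (x : I -> F).
Hypothesis Fx : free_basis x.
Local Notation H := (H1 R F).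
Variable theta : F -> That H.
Hypothesis theta_magnus : magnus_expansion theta.
Implicit Types (phi psi : aut F) (a : F).

Lemma hom_act_cls p phi (v : {linear H -> tpow H p.+1}) a :
  hom_act p phi v (cls R a) = tpow_map (H1_map R phi) p.+1 (v (cls R (phi^-1%g a))).
Proof.
exact: (congr1 (fun h => tpow_map (H1_map R phi) p.+1 (v h))
  (H1_map_cls R phi^-1%g a)).
Qed.

Lemma H1_map_mul phi psi h :
  H1_map R phi (H1_map R psi h) = H1_map R (phi * psi)%g h.
Proof.
apply: (univ_ext (f := H1_map R phi \o H1_map R psi) (g := H1_map R (phi * psi)%g)).
move=> a; rewrite [RHS](H1_map_cls R (phi * psi)%g).
apply: etrans (congr1 (H1_map R phi) (H1_map_cls R psi a)) _.
exact: H1_map_cls.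
Qed.

Lemma H1_map1 h : H1_map R (1%g : aut F) h = h.
Proof.
apply: (univ_ext (f := H1_map R (1%g : aut F)) (g := idfun)).
exact: (H1_map_cls R 1%g).
Qed.

(** The twists by [phi^-1] and [|phi|] cancel in degree 1. Transitivity compares this expansion with
    [theta]. *)
Lemma magnus_conj phi :
  magnus_expansion (fun a => That_map (H1_map R phi) (theta (phi^-1%g a))).
Proof.
have [thM th1 thc] := theta_magnus.
set f := H1_map R phi; split=> [a b|a|a].
- by rewrite autM thM That_map_mul.
- by rewrite -(That_map_one f) -linearB; exact/That_map_ge/th1.
have -> : That_H (cls R a) = That_map f (That_H (cls R (phi^-1%g a))).
  rewrite -!shift1 That_map_shift That_map_one /f H1_map_cls.
  by rewrite (autKV phi a : phi (phi^-1%g a) = a).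
by rewrite -(That_map_one f) -linearD -linearB; exact/That_map_ge/thc.
Qed.

(** Transitivity makes the set from which [xget] chooses nonempty, so the choice has the defining
    property. *)
Lemma total_johnsonP phi : in_IA (total_johnson theta phi) /\
  forall a, theta (phi a) =
    total_johnson theta phi (That_map (H1_map R phi) (theta a)).
Proof.
set P : set {linear That H -> That H} := [set U | in_IA U /\
  forall a, theta (phi a) = U (That_map (H1_map R phi) (theta a))]%classic.
apply: (@xgetPex _ (idfun : {linear That H -> That H}) P).
have [U iU Uth] := magnus_transitive Fx (magnus_conj phi) theta_magnus.
exists U; split=> // a; rewrite -Uth; congr (U (That_map _ (theta _))).
exact: (autK phi a).
Qed.

Lemma magnus_deg1 a : theta a 1 = cls R a.
Proof.
have := magnus_cls theta_magnus a => /That_ge_congr ->.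
by rewrite ThatD /= add0r.
Qed.

Lemma magnus_map_deg1 phi a :
  That_map (H1_map R phi) (theta a) 1 = cls R (phi a).
Proof. by rewrite /That_map magnus_deg1; exact: H1_map_cls. Qed.

Lemma magnus_deg2 phi a : theta (phi a) 2 =
  tpow_map (H1_map R phi) 2 (theta a 2) + johnson theta 1 phi (cls R (phi a)).
Proof.
have [iU ->] := total_johnsonP phi; rewrite (in_IA_deg2 iU).
by rewrite magnus_map_deg1.
Qed.

Lemma magnus_deg3 phi a : theta (phi a) 3 =
  tpow_map (H1_map R phi) 3 (theta a 3) +
  tens_deriv (johnson theta 1 phi) (tpow_map (H1_map R phi) 2 (theta a 2)) +
  johnson theta 2 phi (cls R (phi a)).
Proof.
have [iU ->] := total_johnsonP phi; rewrite (in_IA_deg3 iU).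
by rewrite magnus_map_deg1.
Qed.

Lemma H1_lin_eq (V : lmodType R) (f g : {linear H -> V}) :
  (forall a, f (cls R a) = g (cls R a)) -> f = g.
Proof. by move=> fg; apply/lin_eq/univ_ext. Qed.

Lemma johnson1_mul phi psi :
  johnson theta 1 (phi * psi)%g =
  johnson theta 1 phi + hom_act 1 phi (johnson theta 1 psi).
Proof.
(* [a] is the preimage of [z] under [phi * psi], so that the Johnson maps of [phi] and [phi * psi]
   are evaluated at the class of [z]. *)
apply: H1_lin_eq => z; pose a := psi^-1%g (phi^-1%g z).
have pa : psi a = phi^-1%g z by exact: (autKV psi).
have za : phi (psi a) = z by rewrite pa; exact: (autKV phi).
have ppa : (phi * psi)%g a = z by exact: za.
have e := magnus_deg2 (phi * psi)%g a.
rewrite (magnus_deg2 phi (psi a)) (magnus_deg2 psi a) linearD in e.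
rewrite (tpow_map_comp (H1_map_mul phi psi)) in e.
rewrite ppa za pa -hom_act_cls -addrA in e.
rewrite [RHS]addrC; apply/esym.
by move/addrI: e.
Qed.

Lemma johnson2_mul phi psi :
  johnson theta 2 (phi * psi)%g =
  johnson theta 2 phi + hom_act 2 phi (johnson theta 2 psi)
  + (tens_deriv (johnson theta 1 phi) \o hom_act 1 phi (johnson theta 1 psi)).
Proof.
apply: H1_lin_eq => z; pose a := psi^-1%g (phi^-1%g z).
have pa : psi a = phi^-1%g z by exact: (autKV psi).
have za : phi (psi a) = z by rewrite pa; exact: (autKV phi).
have ppa : (phi * psi)%g a = z by exact: za.
have e := magnus_deg3 (phi * psi)%g a.
(* Splitting the first Johnson map of [phi * psi] yields the two derivation terms in [theta a 2]
   that the iterated expansion produces. *)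
rewrite johnson1_mul tens_derivD in e.
rewrite (magnus_deg3 phi (psi a)) (magnus_deg3 psi a) (magnus_deg2 psi a) in e.
rewrite 2!(linearD (tpow_map (H1_map R phi) 3)) in e.
rewrite (linearD (tpow_map (H1_map R phi) 2)) in e.
rewrite (linearD (tens_deriv (johnson theta 1 phi))) in e.
rewrite !(tpow_map_comp (H1_map_mul phi psi)) in e.
(* The factor [|phi^-1|] in [hom_act] cancels [|phi|]; this is the hypothesis of
   [tens_deriv_map]. *)
have act h : hom_act 1 phi (johnson theta 1 psi) (H1_map R phi h) =
    tpow_map (H1_map R phi) 2 (johnson theta 1 psi h).
  exact: (congr1 (fun h => tpow_map (H1_map R phi) 2 (johnson theta 1 psi h))
    (H1_mapK phi h)).
rewrite (tens_deriv_map act) (tpow_map_comp (H1_map_mul phi psi)) in e.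
rewrite ppa za pa -!hom_act_cls in e.
(* Summands 1, 4 and 2, those in [theta a 3] and [theta a 2], occur on both sides and cancel; 6, 3
   and 5 form the claim. *)
by move: e; rewrite [LHS](AC (3*2*1) (1*(4*2)*(6*3*5))) => /addrI.
Qed.

End JohnsonMaps.

(** * From product formulas to coboundaries: [u] stands for [x f(y)], [v] for [f(x)], and
    [v + u + w] for [f(xy)] *)

Lemma opp_cobound_eq (V : zmodType) (u v w : V) : - (u - (v + u + w) + v) = w.
Proof. by rewrite opprD opprB [v + u + w]addrAC addrK addrAC subrr add0r. Qed.

Theorem lemma2p1 (n : nat) (hn : (2 <= n)%N) (R : comPzRingType)
    (F : groupType) (hF : free_of_rank n F)
    (theta : F -> That (H1 R F)) (htheta : magnus_expansion theta) :
  let tau1 : aut F -> {linear H1 R F -> tpow (H1 R F) 2} := johnson theta 1 in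
  let tau2 : aut F -> {linear H1 R F -> tpow (H1 R F) 3} := johnson theta 2 in
  [/\ normalized1 tau1,
      normalized1 tau2,
      forall phi psi : aut F, - cobound1 (hom_act 1) tau1 phi psi = 0
    & forall phi psi : aut F,
        - cobound1 (hom_act 2) tau2 phi psi =
        hom_comp (cup11 (hom_act 1) (fun phi => tens_deriv (tau1 phi)) tau1 phi psi)].
Proof.
move=> tau1 tau2; have [x Fx] := hF.
have tau1_1 : tau1 1%g = 0.
  (* At the identity [|phi|] is trivial, so the degree 2 relation reads
     [theta a 2 = theta a 2 + tau1 1 (cls a)]. *)
  apply: H1_lin_eq => a; have := magnus_deg2 Fx htheta 1%g a.
  rewrite (tpow_map_id (@H1_map1 R F)) -[LHS]addr0 => /addrI.
  by move=> /esym.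
split.
- exact: tau1_1.
- apply: H1_lin_eq => a; have := magnus_deg3 Fx htheta 1%g a.
  rewrite !(tpow_map_id (@H1_map1 R F)) -/(tau1 1%g) tau1_1 tens_deriv0 addr0.
  rewrite -[LHS]addr0 => /addrI.
  by move=> /esym.
- move=> phi psi; rewrite /cobound1 /tau1 (johnson1_mul Fx htheta).
  (* The added zero is the defect [w] of [opp_cobound_eq]. *)
  rewrite -[_ + hom_act 1 _ _]addr0; exact: opp_cobound_eq.
move=> phi psi; rewrite /cobound1 /tau2 (johnson2_mul Fx htheta) opp_cobound_eq.
(* The cup product is a pure tensor, on which [hom_comp] is composition. *)
exact: (esym (univ_lift_gen (_, _) (@hom_comp_bilin R _ _ _))).
Qed.
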